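(* Let $n\ge 1$ and $p,q\ge 0$ be integers, and let $\boldsymbol{x}=(x_1,\dots,x_n)$, $\boldsymbol{y}=(y_1,\dots,y_n)$, $\boldsymbol{z}=(z_1,\dots,z_{p+q})$, $\boldsymbol{a}=(a_1,\dots,a_n)$, $\boldsymbol{b}=(b_1,\dots,b_n)$, $\boldsymbol{c}=(c_1,\dots,c_{p+q})$ be indeterminates. Then $$ \det\left(\frac{F^{p+1,q+1}(x_i,y_j,\boldsymbol{z};a_i,b_j,\boldsymbol{c})}{(y_j-x_i)(1-x_iy_j)}\right)_{1\le i,j\le n} =\frac{(-1)^{n(n-1)/2}}{\prod_{i,j=1}^n (y_j-x_i)(1-x_iy_j)}\,F^{p,q}(\boldsymbol{z};\boldsymbol{c})^{\,n-1}\,F^{n+p,n+q}(\boldsymbol{x},\boldsymbol{y},\boldsymbol{z};\boldsymbol{a},\boldsymbol{b},\boldsymbol{c}). $$ Here $(x_i,y_j,\boldsymbol z)$ denotes the vector $(x_i,y_j,z_1,\dots,z_{p+q})$ of length $p+q+2$ (similarly for $(a_i,b_j,\boldsymbol c)$), and $(\boldsymbol x,\boldsymbol y,\boldsymbol z)$ denotes the concatenated vector of length $2n+p+q$ (similarly $(\boldsymbol a,\boldsymbol b,\boldsymbol c)$).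
   Context: Partitions: a partition $\lambda=(\lambda_1\ge\lambda_2\ge\cdots)$ of nonnegative integers with finitely many nonzero parts; $l(\lambda)$ is the number of nonzero parts, $|\lambda|=\sum_i\lambda_i$. In Frobenius notation $\lambda=(\alpha_1,\dots,\alpha_d\,|\,\beta_1,\dots,\beta_d)$ where $d=\#\{i:\lambda_i\ge i\}$, $\alpha_i=\lambda_i-i$, $\beta_i=\lambda'_i-i$ ($\lambda'$ the conjugate partition). For an integer $m\ge 0$, $\mathcal{P}_m$ is the set of partitions $\lambda$ with $l(\lambda)\le m$ of the form $(\alpha_1,\dots,\alpha_d\,|\,\alpha_1+1,\dots,\alpha_d+1)$ (the empty partition included; $|\lambda|$ is then even). For nonnegative integers $p,q$, vectors $\boldsymbol{x}=(x_1,\dots,x_{p+q})$, $\boldsymbol{a}=(a_1,\dots,a_{p+q})$, and partitions $\lambda,\mu$ with $l(\lambda)\le p$, $l(\mu)\le q$, let $V^{p,q}_{\lambda,\mu}(\boldsymbol{x};\boldsymbol{a})$ be the $(p+q)\times(p+q)$ matrix whose $i$-th row is $$(x_i^{\lambda_p},x_i^{\lambda_{p-1}+1},\dots,x_i^{\lambda_1+p-1},\ a_ix_i^{\mu_q},a_ix_i^{\mu_{q-1}+1},\dots,a_ix_i^{\mu_1+q-1}).$$ Define $$F^{p,q}(\boldsymbol{x};\boldsymbol{a})=\sum_{\lambda\in\mathcal{P}_p,\ \mu\in\mathcal{P}_q}(-1)^{(|\lambda|+|\mu|)/2}\det V^{p,q}_{\lambda,\mu}(\boldsymbol{x};\boldsymbol{a}),$$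 with the convention that $F^{0,0}=1$ (determinant of the empty matrix). *)

(* Defs.v *)
From HB Require Import structures.
From mathcomp Require Import all_boot all_order all_algebra all_fingroup.
Set Implicit Arguments. Unset Strict Implicit. Unset Printing Implicit Defensive.
Import Order.TTheory GRing.Theory Num.Theory.

(* A partition with at most m nonzero parts is represented by the function
   lam : 'I_m -> nat, with lam k = lambda_{k+1} (0-indexed parts). *)

Definition is_partition (m : nat) (lam : 'I_m -> nat) : bool :=
  [forall i : 'I_m, forall j : 'I_m, (i <= j)%N ==> (lam j <= lam i)%N].

(* conjugate partition: lambda'_i = #{k | lambda_k >= i}   (i is 1-indexed) *)
Definition conjp (m : nat) (lam : 'I_m -> nat) (i : nat) : nat :=
  #|[set k : 'I_m | (i <= lam k)%N]|.

Definition frob_d (m : nat) (lam : 'I_m -> nat) : nat :=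
  #|[set k : 'I_m | (k.+1 <= lam k)%N]|.

(* alpha_i = lambda_i - i, beta_i = lambda'_i - i (for 1 <= i <= d, both >= 0);
   lambda = (alpha_1..alpha_d | alpha_1+1..alpha_d+1) iff beta_i = alpha_i + 1. *)
Definition in_P (m : nat) (lam : 'I_m -> nat) : bool :=
  is_partition lam &&
  [forall k : 'I_m, (k < frob_d lam)%N ==>
     (conjp lam k.+1 - k.+1 == (lam k - k.+1).+1)%N].

Definition psize (m : nat) (lam : 'I_m -> nat) : nat := (\sum_(k < m) lam k)%N.

Section F.
Variable R : comRingType.
Local Open Scope ring_scope.

(* The matrix V^{p,q}_{lam,mu}(x;a); x and a are given as sequences,
   x`_i being x_{i+1}. Column j < p (0-indexed) is x_i^(lambda_{p-j} + j),
   column p + j is a_i x_i^(mu_{q-j} + j). *)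
Definition Vmat (p q : nat) (lam : 'I_p -> nat) (mu : 'I_q -> nat)
    (x a : seq R) : 'M[R]_(p + q) :=
  \matrix_(i, j) match split j with
                 | inl j' => x`_i ^+ (lam (rev_ord j') + j')
                 | inr j' => a`_i * x`_i ^+ (mu (rev_ord j') + j')
                 end.

(* F^{p,q}(x;a). Every lam in P_p satisfies lambda_1 = lambda'_1 - 1 <= p - 1,
   so summing over functions 'I_p -> 'I_p.+1 (parts <= p) enumerates all of P_p. *)
Definition Ffun (p q : nat) (x a : seq R) : R :=
  \sum_(lam : {ffun 'I_p -> 'I_p.+1} | in_P (fun k => val (lam k)))
  \sum_(mu : {ffun 'I_q -> 'I_q.+1} | in_P (fun k => val (mu k)))
    (-1) ^+ ((psize (fun k => val (lam k)) + psize (fun k => val (mu k)))./2)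
    * \det (Vmat (fun k => val (lam k)) (fun k => val (mu k)) x a).

End F.

(* Main.v *)
Require Import Defs.
From HB Require Import structures.
From mathcomp Require Import all_boot all_order all_algebra all_fingroup.
From mathcomp Require Import zify ring.
Set Implicit Arguments. Unset Strict Implicit. Unset Printing Implicit Defensive.

(** The set P_{p+1} splits into partitions with a zero last part and partitions
    with a full first hook; removing the zero part or the hook gives P_p, so
    multilinearity turns the signed sum over P_p into the determinant with columns
    x^j + x^(2p-2-j) (and x^(p-1)).  With u = x + 1/x these columns are, up to the
    factor x^(p-1) and unitriangular column operations, the powers of u, so
    F^{p,q}(x; a) becomes a Vandermonde-type determinant V^{p,q}(u; a x^(q-p)),
    while (y - x)(1 - x y) = x y (u_x - u_y).

    If V^{p,q}(z; c) is nonzero there are phi = u^p + ... and psi = a u^q + ... in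
    the span of the columns of V^{p+1,q+1} vanishing at z, and
    V^{n+p,n+q}(x, y, z) factors as (-1)^(np) V^{p,q}(z) times the determinant with
    columns u^k phi, u^k psi (k < n).  The case n = 1 identifies the entries with
    phi(x) psi(y) - psi(x) phi(y), and Lagrange interpolation at the x_i evaluates the
    resulting Cauchy-like determinant.

    The genericity assumptions are removed by clearing denominators and deforming
    the data over R[U][T]. *)

(** * Partitions (alpha | alpha + 1) *)

Definition conj_count (p : nat) (f : nat -> nat) (i : nat) : nat :=
  count (fun k => i <= f k) (iota 0 p).

(** For 0-based [k], the test [k < f k] says that row [k] meets the diagonal, and [beta = alpha + 1]
    becomes [lambda' = lambda + 1], free of truncated subtraction. *)
Definition frob_shift (p : nat) (f : nat -> nat) : Prop :=
  (forall i j, i <= j < p -> f j <= f i) /\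
  (forall k, k < p -> k < f k -> conj_count p f k.+1 = (f k).+1).

Lemma conj_count_le p f i : conj_count p f i <= p.
Proof. by rewrite /conj_count; have := count_size (fun k => i <= f k) (iota 0 p); rewrite size_iota. Qed.

Lemma conj_countSr p f i : conj_count p.+1 f i = conj_count p f i + (i <= f p).
Proof. by rewrite /conj_count -(addn1 p) iotaD count_cat /= addn0. Qed.

Lemma conj_countSl p f i : conj_count p.+1 f i = (i <= f 0) + conj_count p (fun k => f k.+1) i.
Proof. by rewrite /conj_count /= -(addn0 1) iotaDl count_map; congr (_ + _). Qed.

(** A downward closed [P] holds exactly on an initial segment, whose length is the count. This turns
    comparison with [frob_d] into the pointwise test [k < f k]. *)
Lemma count_initial (P : pred nat) p k :
  (forall i j, i <= j < p -> P j -> P i) -> k < p ->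
  (k < count P (iota 0 p)) = P k.
Proof.
elim: p k => [//|p IH] k H kp.
have H' i j : i <= j < p -> P j -> P i by move=> ?; apply: H; lia.
rewrite -(addn1 p) iotaD count_cat /= addn0 add0n.
have [Pp|nPp] := boolP (P p).
  have -> : count P (iota 0 p) = p.
    rewrite -[RHS](size_iota 0); apply/eqP; rewrite -all_count.
    by apply/allP => i; rewrite mem_iota => ?; apply: (H i p) => //; lia.
  by rewrite addn1 kp; apply/esym; apply: (H k p) => //; lia.
rewrite addn0; have [kp'|pk] := ltnP k p; first exact: IH.
have -> : k = p by lia.
rewrite (negbTE nPp); apply/negbTE; rewrite -leqNgt.
by have := count_size P (iota 0 p); rewrite size_iota.
Qed.

Lemma card_ord_count (p : nat) (P : pred nat) :
  #|[set k : 'I_p | P k]| = count P (iota 0 p).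
Proof.
rewrite cardE -val_enum_ord count_map -size_filter; congr size.
by rewrite {1}/enum_mem -enumT; apply: eq_filter => k; rewrite /= inE.
Qed.

Lemma eq_in_P m (f g : 'I_m -> nat) : f =1 g -> in_P f = in_P g.
Proof.
move=> E; have Ed : frob_d f = frob_d g by apply: eq_card => j; rewrite !inE E.
have Ec k : conjp f k = conjp g k by apply: eq_card => j; rewrite !inE E.
rewrite /in_P Ed; congr (_ && _).
  by apply: eq_forallb => i; apply: eq_forallb => j; rewrite !E.
by apply: eq_forallb => i; rewrite Ec E.
Qed.

Lemma in_PP p (f : nat -> nat) :
  reflect (frob_shift p f) (in_P (fun k : 'I_p => f k)).
Proof.
have E1 i : conjp (fun k : 'I_p => f k) i = conj_count p f i.
  exact: (card_ord_count p (fun k => i <= f k)).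
have E2 : frob_d (fun k : 'I_p => f k) = count (fun k => k < f k) (iota 0 p).
  exact: (card_ord_count p (fun k => k < f k)).
have mono : is_partition (fun k : 'I_p => f k) ->
    forall i j, i <= j < p -> f j <= f i.
  move=> /forallP H i j /andP[ij jp].
  have /forallP/(_ (Ordinal jp))/implyP := H (Ordinal (leq_ltn_trans ij jp)).
  exact.
have frob : (forall i j, i <= j < p -> f j <= f i) -> forall k, k < p ->
    (k < frob_d (fun k : 'I_p => f k)) = (k < f k).
  move=> H k kp; rewrite E2 (count_initial (P := fun k => k < f k)) //.
  by move=> i j ij; have := H i j ij; lia.
apply: (iffP andP) => [[/mono H1 /forallP H2]|[H1 H2]]; split => //.
- move=> k kp kf; have := H2 (Ordinal kp); rewrite (frob H1) //= kf /= E1 => /eqP.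
  lia.
- by apply/forallP => i; apply/forallP => j; apply/implyP => ij; apply: H1; rewrite ij /=.
- apply/forallP => k; apply/implyP; rewrite (frob H1) // => kf.
  by rewrite E1 H2 //; apply/eqP; lia.
Qed.

(** A nonempty partition has [lambda_1 + 1 = lambda'_1 <= p]. Hence the bound on parts built into
    [Ffun] loses no partition. *)
Lemma frob_shift_bound p f k : frob_shift p f -> k < p -> f k < p.
Proof.
move=> [H1 H2] kp; have f0 : f k <= f 0 by apply: H1.
have p0 : 0 < p by lia.
case: (posnP (f 0)) => [|f0p]; first by lia.
by have := H2 0 p0 f0p; have := conj_count_le p f 1; lia.
Qed.

(** If the last part is positive, the first column is full, and [lambda'_1 = p + 1] forces
    [lambda_1 = p]. Deleting the first row and column leaves the other Frobenius coordinates
    unchanged. *)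
Lemma frob_shift_rec p f : 0 < p ->
  frob_shift p.+1 f <->
  (f p = 0 /\ frob_shift p f) \/
  [/\ f 0 = p, forall k, k <= p -> 0 < f k
    & frob_shift p (fun k => (f k.+1).-1)].
Proof.
move=> p0; split.
  move=> [H1 H2]; have [fp|fp] := posnP (f p).
    left; split=> //; split=> [i j ij|k kp kf]; first by apply: H1; lia.
    by have := H2 k _ kf; rewrite conj_countSr fp addn0; apply; lia.
  right; have pos k : k <= p -> 0 < f k.
    by move=> kp; apply: leq_trans fp _; apply: H1; lia.
  have full : conj_count p.+1 f 1 = p.+1.
    rewrite /conj_count -[RHS](size_iota 0); apply/eqP; rewrite -all_count.
    by apply/allP => i; rewrite mem_iota => ?; apply: pos; lia.
  split=> //; first by have := H2 0 isT (pos 0 isT); lia.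
  split=> [i j ij|k kp kf]; first by have := H1 i.+1 j.+1 _; lia.
  have := H2 k.+1; rewrite conj_countSl.
  have -> : conj_count p (fun k0 => f k0.+1) k.+2 = conj_count p (fun k0 => (f k0.+1).-1) k.+1.
    by apply: eq_count => j /=; lia.
  have := H1 0 k.+1; lia.
case=> [[fp [H1 H2]]|[f0 pos Hg]].
  split=> [i j ij|k kp kf].
    have [jp|jp] := ltnP j p; first by apply: H1; lia.
    by rewrite (_ : j = p) ?fp //; lia.
  have kp' : k < p.
    by case: (eqVneq k p) kf => [->|]; rewrite ?fp //; lia.
  by rewrite conj_countSr fp addn0; apply: H2.
have g0 := frob_shift_bound Hg.
case: (Hg) => H1 H2; have mono i j : i <= j < p.+1 -> f j <= f i.
  case: i j => [|i] [|j] //= ij.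
    by case: ij => ij; have /= := g0 j; lia.
  by have := H1 i j; have := pos i.+1; have := pos j.+1; lia.
split=> // -[|k] kp kf.
  rewrite /conj_count f0 -[RHS](size_iota 0); apply/eqP; rewrite -all_count.
  by apply/allP => i; rewrite mem_iota => ?; apply: pos; lia.
have := H2 k; rewrite conj_countSl.
have -> : conj_count p (fun k0 => f k0.+1) k.+2 = conj_count p (fun k0 => (f k0.+1).-1) k.+1.
  by apply: eq_count => j /=; lia.
by have := mono 0 k.+1; lia.
Qed.

(** Size 1 is a base case of its own: from the empty list both extensions would give [[:: 0]], and
    the enumeration would repeat it. *)
Fixpoint shifted_parts (p : nat) : seq (seq nat) :=
  match p with
  | 0 => [:: [::]]
  | 1 => [:: [:: 0]]
  | (p'.+1 as r).+1 =>
    [seq rcons l 0 | l <- shifted_parts r] ++ [seq r :: map S l | l <- shifted_parts r]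
  end.

Lemma shifted_partsSS p : shifted_parts p.+2 =
  [seq rcons l 0 | l <- shifted_parts p.+1] ++ [seq p.+1 :: map S l | l <- shifted_parts p.+1].
Proof. by []. Qed.

Lemma eq_frob_shift p f g : (forall k, k < p -> f k = g k) ->
  frob_shift p f -> frob_shift p g.
Proof.
move=> E [H1 H2]; split=> [i j ij|k kp kf].
  by have := H1 i j ij; rewrite !E //; lia.
rewrite -E // -H2 // ?E //; apply: eq_in_count => i.
by rewrite mem_iota => ?; rewrite E //; lia.
Qed.

Lemma mem_shifted_parts p l : l \in shifted_parts p <-> size l = p /\ frob_shift p (nth 0 l).
Proof.
elim: p l => [|[|p] IH] l.
- rewrite inE; split=> [/eqP->|[/size0nil -> //]].
  by split=> //; split=> // i j; rewrite ltn0 andbF.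
- rewrite inE; split=> [/eqP->|].
    have E k : nth 0 [:: 0] k = 0 by case: k => [|[]].
  by split=> //; split=> [i j|k]; rewrite !E.
  case: l => [|x [|y l]] // [] // _ [_ /(_ 0 isT)] /=.
  by case: x => // x /(_ isT).
rewrite shifted_partsSS mem_cat; split.
  case/orP => /mapP[m /IH [sm Hm] ->].
    split; first by rewrite size_rcons sm.
    apply/frob_shift_rec => //; left; split; first by rewrite nth_rcons sm ltnn eqxx.
    by apply: eq_frob_shift Hm => k kp; rewrite nth_rcons sm kp.
  split; first by rewrite /= size_map sm.
  apply/frob_shift_rec => //; right; split=> //.
    by move=> [|k] //= kp; rewrite (nth_map 0) ?sm.
  by apply: eq_frob_shift Hm => k kp /=; rewrite (nth_map 0) ?sm.
case=> sl /frob_shift_rec [//|[f0 H]|[f0 pos H]]; apply/orP; [left|right].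
  case/lastP: l => [//|l x] in sl f0 H *.
  move: sl f0; rewrite size_rcons => -[sl].
  rewrite nth_rcons sl ltnn eqxx => ->; apply: map_f; apply/IH; split=> //.
  by apply: eq_frob_shift H => k kp; rewrite nth_rcons sl kp.
case: l => [//|x l] in sl f0 pos H *.
move: sl f0 => /= [sl] ->; apply/mapP; exists (map predn l).
  apply/IH; split; first by rewrite size_map.
  by apply: eq_frob_shift H => k kp /=; rewrite (nth_map 0) ?sl.
congr (_ :: _); rewrite -map_comp -[LHS]map_id; apply/eq_in_map => y.
move=> /(nthP 0) [k kl <-] /=; rewrite prednK //.
by apply: (pos k.+1); rewrite -sl.
Qed.

Lemma uniq_shifted_parts p : uniq (shifted_parts p).
Proof.
elim: p => [|[|p] IH] //; rewrite shifted_partsSS cat_uniq; apply/and3P; split.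
- by rewrite map_inj_uniq // => l m /rcons_inj [].
- apply/hasPn => l /mapP[m _ ->]; apply/negP => /mapP[k _ E].
  have : 0 \in p.+1 :: map S m by rewrite E mem_rcons inE eqxx.
  by rewrite inE => /orP[//|/mapP[]].
- by rewrite map_inj_uniq // => l m [] /(inj_map succn_inj).
Qed.

Import GRing.Theory.
Local Open Scope ring_scope.

Lemma sum_in_P (R : nmodType) p (G : ('I_p -> nat) -> R) :
  (forall f g, f =1 g -> G f = G g) ->
  \sum_(lam : {ffun 'I_p -> 'I_p.+1} | in_P (fun k => val (lam k)))
     G (fun k => val (lam k)) =
  \sum_(l <- shifted_parts p) G (fun k : 'I_p => nth 0%N l k).
Proof.
move=> Gext.
pose sf (lam : {ffun 'I_p -> 'I_p.+1}) := [seq val (lam k) | k <- enum 'I_p].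
have sfE lam (k : 'I_p) : nth 0%N (sf lam) k = lam k.
  by rewrite (nth_map k) ?size_enum_ord // nth_ord_enum.
have sf_inj : injective sf.
  by move=> l m E; apply/ffunP => k; apply: val_inj; rewrite /= -!sfE E.
rewrite (eq_bigr (fun lam => G (fun k : 'I_p => nth 0%N (sf lam) k))); last first.
  by move=> lam _; apply: Gext => k; rewrite sfE.
pose P := [pred lam : {ffun 'I_p -> 'I_p.+1} | in_P (fun k => val (lam k))].
transitivity (\sum_(lam in P) G (fun k : 'I_p => nth 0%N (sf lam) k)).
  by apply: eq_bigl.
rewrite -big_enum -(big_map sf predT (fun l => G (fun k : 'I_p => nth 0%N l k))).
apply: perm_big; apply: uniq_perm; rewrite ?uniq_shifted_parts //.
  by rewrite map_inj_uniq // enum_uniq.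
have inPE (lam : {ffun 'I_p -> 'I_p.+1}) : in_P (fun k : 'I_p => val (lam k)) =
    in_P (fun k : 'I_p => nth 0%N (sf lam) k).
  by apply: eq_in_P => k; rewrite sfE.
move=> l; apply/mapP/idP => [[lam]|/mem_shifted_parts [sl H]].
  rewrite mem_enum inE inPE => /in_PP H ->; apply/mem_shifted_parts; split=> //.
  by rewrite size_map size_enum_ord.
pose lam0 : {ffun 'I_p -> 'I_p.+1} := [ffun k : 'I_p => inord (nth 0%N l k)].
have E : l = sf lam0.
  apply: (@eq_from_nth _ 0%N); first by rewrite size_map size_enum_ord.
  move=> i; rewrite sl => ip; rewrite (sfE _ (Ordinal ip)) ffunE inordK //=.
  by rewrite ltnS ltnW //; apply: frob_shift_bound H _.
exists lam0 => //.
by rewrite mem_enum inE inPE -E; apply/in_PP.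
Qed.

(** * Determinants as functions of a list of columns *)

Section ColumnDet.
Variable R : comNzRingType.

(** A list of columns lets blocks be exchanged and substituted by concatenation. Missing columns
    read as zero and columns beyond [N] are ignored, hence the size bounds below. *)
Definition col_det N (s : seq 'cV[R]_N) : R := \det (\matrix_(i, j) nth 0 s j i 0).

Lemma nth_cat_cons_neq (T : Type) (x0 : T) s1 s2 u v i : i != size s1 ->
  nth x0 (s1 ++ u :: s2) i = nth x0 (s1 ++ v :: s2) i.
Proof.
move=> ne; rewrite !nth_cat; case: ltnP => // le.
by case E : (i - size s1)%N => [|//]; move: ne; rewrite eqn_leq le andbT -subn_eq0 E.
Qed.

Lemma nth0_map (U V : nmodType) (f : U -> V) (s : seq U) i : f 0 = 0 ->
  nth 0 (map f s) i = f (nth 0 s i).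
Proof.
move=> f0; have [h|h] := ltnP i (size s); first exact: nth_map.
by rewrite !nth_default ?size_map // f0.
Qed.

Lemma col_det_lin N (s1 s2 : seq 'cV[R]_N) a b u v : (size s1 < N)%N ->
  col_det (s1 ++ (a *: u + b *: v) :: s2) =
  a * col_det (s1 ++ u :: s2) + b * col_det (s1 ++ v :: s2).
Proof.
move=> h; rewrite /col_det -[LHS]det_tr -[X in a * X]det_tr -[X in b * X]det_tr.
apply: (determinant_multilinear (i0 := Ordinal h)).
- by apply/rowP => j; rewrite !mxE !nth_cat ltnn subnn /= !mxE.
- apply/matrixP => k j; rewrite !mxE; congr (fun_of_matrix _ j 0).
  by apply: nth_cat_cons_neq; rewrite eq_sym; apply: neq_bump.
- apply/matrixP => k j; rewrite !mxE; congr (fun_of_matrix _ j 0).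
  by apply: nth_cat_cons_neq; rewrite eq_sym; apply: neq_bump.
Qed.

Lemma col_det_alt N (s : seq 'cV[R]_N) i j : (i < j < N)%N ->
  nth 0 s i = nth 0 s j -> col_det s = 0.
Proof.
move=> /andP[ij jN] E; rewrite /col_det -det_tr.
apply: (@determinant_alternate _ _ _ (Ordinal (ltn_trans ij jN)) (Ordinal jN)).
  by rewrite -val_eqE /= neq_ltn ij.
by move=> k; rewrite !mxE /= E.
Qed.

Lemma col_det_mem N (s1 s2 : seq 'cV[R]_N) u : u \in s1 ++ s2 ->
  (size (s1 ++ u :: s2) <= N)%N -> col_det (s1 ++ u :: s2) = 0.
Proof.
rewrite size_cat /= mem_cat => /orP[] /(nthP 0)[i ilt <-] sN.
  apply: (@col_det_alt _ _ i (size s1)); first by rewrite ilt; lia.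
  by rewrite !nth_cat ilt ltnn subnn.
apply: (@col_det_alt _ _ (size s1) (size s1 + i.+1)%N).
  by rewrite -addSnnS leq_addr /= (leq_trans _ sN) // addSnnS ltn_add2l ltnS.
by rewrite !nth_cat ltnn subnn ltnNge leq_addr /= addKn.
Qed.

Lemma col_det_scale N (s1 s2 : seq 'cV[R]_N) a u : (size s1 < N)%N ->
  col_det (s1 ++ (a *: u) :: s2) = a * col_det (s1 ++ u :: s2).
Proof. by move=> h; have := col_det_lin s2 a 0 u 0 h; rewrite scale0r addr0 mul0r addr0. Qed.

Lemma col_det_add N (s1 s2 : seq 'cV[R]_N) u v : (size s1 < N)%N ->
  col_det (s1 ++ (u + v) :: s2) = col_det (s1 ++ u :: s2) + col_det (s1 ++ v :: s2).
Proof. by move=> h; have := col_det_lin s2 1 1 u v h; rewrite !scale1r !mul1r. Qed.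

Lemma col_det_replace N (s1 s2 : seq 'cV[R]_N) c (I : eqType) (r : seq I) g v :
  (size (s1 ++ c :: s2) <= N)%N -> (forall l, l \in r -> v l \in s1 ++ s2) ->
  col_det (s1 ++ (c + \sum_(l <- r) g l *: v l) :: s2) = col_det (s1 ++ c :: s2).
Proof.
rewrite size_cat /= => sN; have h : (size s1 < N)%N by lia.
elim: r => [|l r IH] H; first by rewrite big_nil addr0.
rewrite big_cons addrCA col_det_add // col_det_scale // col_det_mem ?mulr0 ?add0r //.
- by apply: IH => k kr; apply: H; rewrite inE kr orbT.
- by apply: H; rewrite inE eqxx.
- by rewrite size_cat.
Qed.

(** Expand the vanishing determinant that has [u + v] in both places. *)
Lemma col_det_swap N (s1 s2 : seq 'cV[R]_N) u v :
  (size (s1 ++ u :: v :: s2) <= N)%N ->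
  col_det (s1 ++ u :: v :: s2) = - col_det (s1 ++ v :: u :: s2).
Proof.
rewrite size_cat /= => sN; have h : (size s1 < N)%N by lia.
have Z w : col_det (s1 ++ w :: w :: s2) = 0.
  by apply: col_det_mem; rewrite ?size_cat // mem_cat inE eqxx orbT.
have := Z (u + v); rewrite col_det_add // -(cat_rcons u s1 (u + v :: _)) -(cat_rcons v s1 (u + v :: _)).
rewrite !col_det_add ?size_rcons ?cat_rcons ?Z; try lia.
by rewrite add0r addr0 => /eqP; rewrite addr_eq0 => /eqP.
Qed.

Lemma col_det_move N (s1 t s2 : seq 'cV[R]_N) u :
  (size (s1 ++ u :: t ++ s2) <= N)%N ->
  col_det (s1 ++ u :: t ++ s2) = (-1) ^+ size t * col_det (s1 ++ t ++ u :: s2).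
Proof.
elim: t s1 => [|v t IH] s1 /=; first by rewrite mul1r.
move=> sN; rewrite col_det_swap // -cat_rcons IH.
  by rewrite cat_rcons exprS mulN1r mulNr.
by move: sN; rewrite !size_cat /= size_rcons size_cat; lia.
Qed.

Lemma col_det_move_block N (s1 t1 t2 s2 : seq 'cV[R]_N) :
  (size (s1 ++ t1 ++ t2 ++ s2) <= N)%N ->
  col_det (s1 ++ t1 ++ t2 ++ s2) =
  (-1) ^+ (size t1 * size t2) * col_det (s1 ++ t2 ++ t1 ++ s2).
Proof.
elim: t1 s1 => [|u t1 IH] s1 sN /=; first by rewrite mul1r.
rewrite -cat_rcons IH; last by move: sN; rewrite !(size_cat, size_rcons) /= ?(size_cat, size_rcons); lia.
rewrite cat_rcons col_det_move; last by move: sN; rewrite !(size_cat, size_rcons) /= ?(size_cat, size_rcons); lia.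
by rewrite mulrA -exprD mulSn addnC.
Qed.

Lemma col_det_block m k (s1 s2 : seq 'cV[R]_(m + k)) : size s1 = m ->
  (forall c, c \in s1 -> dsubmx c = 0) ->
  col_det (s1 ++ s2) = col_det (map usubmx s1) * col_det (map dsubmx s2).
Proof.
move=> sm H; rewrite /col_det.
set A := (X in \det X = _).
rewrite -[A]submxK.
have -> : dlsubmx A = 0.
  apply/matrixP => i j; rewrite !mxE nth_cat /= sm ltn_ord.
  have := H (nth 0 s1 j); rewrite mem_nth ?sm // => /(_ isT)/matrixP/(_ i 0).
  by rewrite !mxE.
rewrite det_ublock; congr (_ * _); congr (\det _); apply/matrixP => i j; rewrite !mxE.
  by rewrite nth_cat /= sm ltn_ord nth0_map ?linear0 // mxE.
by rewrite nth_cat /= sm ltnNge leq_addr /= addKn nth0_map ?linear0 // mxE.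
Qed.

Lemma col_det_rows N (d : 'I_N -> R) (s : seq 'cV[R]_N) :
  col_det [seq \col_i (d i * c i 0) | c : 'cV[R]_N <- s] = (\prod_i d i) * col_det s.
Proof.
rewrite /col_det; have -> : \prod_i d i = \det (diag_mx (\row_i d i)).
  by rewrite det_diag; apply: eq_bigr => i _; rewrite mxE.
rewrite -det_mulmx; congr (\det _); apply/matrixP => i j.
rewrite mul_diag_mx !mxE nth0_map ?mxE //.
by apply/matrixP => a b; rewrite !mxE mulr0.
Qed.

End ColumnDet.

(** * F as a Vandermonde-type determinant *)

Arguments shifted_parts : simpl never.

Definition exponents (l : seq nat) : seq nat :=
  [seq (nth 0 (rev l) j + j)%N | j <- iota 0 (size l)].

Arguments exponents : simpl never.

Lemma exponents_rcons0 l : exponents (rcons l 0%N) = 0%N :: map S (exponents l).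
Proof.
rewrite /exponents size_rcons rev_rcons /= (iotaDl 1 0) -!map_comp; congr (_ :: _).
by apply: eq_map => j /=; rewrite addnS.
Qed.

(** As in [exponents_rcons0], the old exponents go up by one; only the new column differs, with
    exponent [2k] at the end instead of [0] at the front. The two extensions of [l] can therefore be
    paired. *)
Lemma exponents_hook l k : k = size l ->
  exponents (k :: map S l) = rcons (map S (exponents l)) (k + k).
Proof.
move=> ->; rewrite {1}/exponents [size (_ :: _)]/= size_map -(addn1 (size l)) iotaD map_cat add0n.
rewrite [X in _ ++ X]/= cats1 rev_cons nth_rcons size_rev size_map ltnn eqxx.
congr rcons; rewrite -map_comp; apply/eq_in_map => j; rewrite mem_iota /= => jl.
by rewrite nth_rcons size_rev size_map jl -map_rev (nth_map 0%N) // size_rev.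
Qed.

Definition downto (p : nat) : seq nat := rev (iota 0 p).

Arguments downto : simpl never.

Lemma downtoS p : downto p.+1 = p :: downto p.
Proof. by rewrite /downto -(addn1 p) iotaD rev_cat. Qed.

Lemma size_downto p : size (downto p) = p.
Proof. by rewrite size_rev size_iota. Qed.

Lemma mem_downto p e : (e \in downto p) = (e < p)%N.
Proof. by rewrite mem_rev mem_iota. Qed.

Lemma size_shifted_parts p l : l \in shifted_parts p -> size l = p.
Proof. by case/mem_shifted_parts. Qed.

Lemma sumn_mapS l : sumn (map S l) = (size l + sumn l)%N.
Proof. by elim: l => //= a l ->; lia. Qed.

(** A new hook adds twice the number of old rows. Evenness lets the halved size of a pair of
    partitions split into two halves. *)
Lemma even_shifted_parts p l : l \in shifted_parts p -> ~~ odd (sumn l).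
Proof.
elim: p l => [|[|p] IH] l; try by rewrite inE => /eqP->.
rewrite shifted_partsSS mem_cat => /orP[] /mapP[m mP ->].
  by rewrite sumn_rcons addn0; apply: IH.
by rewrite /= sumn_mapS (size_shifted_parts mP); have := IH m mP; lia.
Qed.

Lemma nth_downto r (k : 'I_r) : nth 0%N (downto r) k = rev_ord k.
Proof. by rewrite nth_rev ?size_iota // nth_iota ?add0n //; have := ltn_ord k; lia. Qed.

Section Joukowski.
Variable K : fieldType.

(** The Chebyshev recurrence refers to two previous degrees, so the induction carries two
    consecutive cases. [T] is the part below the leading power and is the same for all [x]. *)
Lemma chebyshev p : exists2 T : {poly K}, (size T <= p.+1)%N &
  forall x : K, x != 0 ->
    x ^+ p.+1 + x ^- p.+1 = (x + x^-1) ^+ p.+1 + T.[x + x^-1].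
Proof.
suff [] : (exists2 T : {poly K}, (size T <= p.+1)%N &
  forall x : K, x != 0 ->
    x ^+ p.+1 + x ^- p.+1 = (x + x^-1) ^+ p.+1 + T.[x + x^-1]) /\
  (exists2 T : {poly K}, (size T <= p.+2)%N &
  forall x : K, x != 0 ->
    x ^+ p.+2 + x ^- p.+2 = (x + x^-1) ^+ p.+2 + T.[x + x^-1]) by [].
elim: p => [|p [[T sT HT] [S sS HS]]].
  split; first by exists 0 => [|x x0]; rewrite ?size_poly0 // horner0 !expr1 addr0.
  exists (- 2%:P) => [|x x0]; first by rewrite size_polyN (leq_trans (size_polyC_leq1 _)).
  by rewrite hornerN hornerC; field.
split; first by exists S.
(* With [u = x + 1/x], this is [x^(m+1) + x^-(m+1) = u (x^m + x^-m) - (x^(m-1) + x^-(m-1))] after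
   removal of the leading power. *)
exists ('X * S - 'X^(p.+1) - T) => [|x x0].
  apply: leq_trans (size_polyD _ _) _; rewrite geq_max size_polyN; apply/andP; split; last by apply: leq_trans sT _; lia.
  apply: leq_trans (size_polyD _ _) _; rewrite geq_max size_polyN size_polyXn leqnSn andbT.
  by apply: leq_trans (size_polyMleq _ _) _; rewrite size_polyX.
rewrite !(hornerD, hornerN, hornerM, hornerX, hornerXn).
have -> : S.[x + x^-1] = x ^+ p.+2 + x ^- p.+2 - (x + x^-1) ^+ p.+2.
  by rewrite HS //; ring.
have -> : T.[x + x^-1] = x ^+ p.+1 + x ^- p.+1 - (x + x^-1) ^+ p.+1.
  by rewrite HT //; ring.
rewrite !exprS; move: (x ^+ p) (expf_neq0 p x0) ((x + x^-1) ^+ p) => y y0 w.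

by field; rewrite ?y0 ?x0.
Qed.

(** The two extensions of each partition merge their extra columns into one. That column joins [s1],
    and the others gain a factor [x] absorbed in [c]; hence the induction over all [c] and [s1]. *)
Lemma sum_shifted_parts_col_det N p (c xs : 'I_N -> K) (s1 s2 : seq 'cV[K]_N) :
  (forall i, xs i != 0) -> (size s1 + p + size s2 <= N)%N ->
  \sum_(l <- shifted_parts p) (-1) ^+ (sumn l)./2 *
    col_det (s1 ++ [seq \col_i (c i * xs i ^+ e) | e <- exponents l] ++ s2) =
  col_det (s1 ++ [seq \col_i (c i * xs i ^+ p.-1 * (xs i + (xs i)^-1) ^+ e)
      | e <- downto p] ++ s2).
Proof.
move=> xs0; elim: p c s1 => [|[|p] IH] c s1 sN.
- by rewrite big_seq1 mul1r.
- rewrite big_seq1 mul1r; congr (col_det (_ ++ _ :: _)).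
  by apply/colP => i; rewrite !mxE !expr0 !mulr1.
pose w0 : 'cV[K]_N := \col_i c i.
pose w1 : 'cV[K]_N := \col_i (c i * xs i ^+ (p.+1 + p.+1)).
pose M l : seq 'cV[K]_N := [seq \col_i (c i * xs i * xs i ^+ e) | e <- exponents l].
have ME l : [seq \col_i (c i * xs i ^+ e) | e <- map S (exponents l)] = M l.
  rewrite -map_comp; apply: eq_map => e; apply/colP => i.
  by rewrite !mxE exprS mulrA.
have h : (size s1 < N)%N by lia.
transitivity (\sum_(l <- shifted_parts p.+1) (-1) ^+ (sumn l)./2 *
    col_det (rcons s1 (w0 + w1) ++ M l ++ s2)).
  rewrite shifted_partsSS big_cat !big_map -[LHS]/(_ + _) -big_split.
  apply: eq_big_seq => l lP; have sl := size_shifted_parts lP; rewrite -[LHS]/(_ + _).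
  have sM : size (M l) = p.+1 by rewrite !size_map size_iota.
  have -> : (sumn (p.+1 :: map S l))./2 = (p.+1 + (sumn l)./2)%N.
    by rewrite /= sumn_mapS sl; lia.
  rewrite sumn_rcons addn0 exponents_rcons0 exponents_hook // map_rcons /= !ME.
  (* Moving [w1] across the [p.+1] columns of [M l] costs [(-1)^(p.+1)], which is also the sign of
     the extra hook of size [2 * p.+1]; the two cancel. *)
  rewrite -cats1 -catA col_det_move_block; last by rewrite !size_cat sM /=; lia.
  rewrite sM muln1 /=.
  rewrite exprD mulrACA -expr2 sqrr_sign mul1r -mulrDr cat_rcons -col_det_add //.
  congr (_ * col_det (_ ++ (_ + _) :: _)); apply/colP => i; rewrite !mxE //.
  by rewrite expr0 mulr1.
rewrite IH ?size_rcons; last by lia.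
rewrite cat_rcons [downto p.+2]downtoS /=.
have [T sT HT] := chebyshev p.
set L := (X in col_det (_ ++ _ :: X ++ _)).
have -> : [seq \col_i (c i * xs i ^+ p.+1 * (xs i + (xs i)^-1) ^+ e) | e <- downto p.+1] = L.
  by apply: eq_map => e; apply/colP => i; rewrite !mxE exprS mulrA.
pose v e : 'cV[K]_N := \col_i (c i * xs i ^+ p.+1 * (xs i + (xs i)^-1) ^+ e).
(* For [m = p.+1], [1 + x^(2m) = x^m (x^m + x^-m)]; below its leading term, the expansion in
   [x + 1/x] only involves columns already in [L]. *)
have -> : w0 + w1 = v p.+1 + \sum_(e <- iota 0 p.+1) T`_e *: v e.
  apply/colP => i; rewrite !mxE summxE -[iota 0 p.+1]/(index_iota 0 p.+1) big_mkord.
  rewrite exprD.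
  transitivity (c i * xs i ^+ p.+1 * (xs i ^+ p.+1 + xs i ^- p.+1)).
    by have := expf_neq0 p.+1 (xs0 i); move: (xs i ^+ p.+1) => X X0; field.
  rewrite HT // mulrDr; congr (_ + _); rewrite (horner_coef_wide _ sT) mulr_sumr.
  by apply: eq_bigr => e _; rewrite !mxE; ring.
rewrite col_det_replace //.
  by rewrite size_cat /= size_cat size_map size_downto; lia.
move=> e; rewrite mem_iota => /= ep; rewrite !mem_cat; apply/orP; right.
apply/orP; left; apply/mapP; exists e; first by rewrite mem_downto.
by apply/colP => i; rewrite !mxE exprS mulrA.
Qed.

Lemma det_Vmat_col_det p q (l m : seq nat) (x a : seq K) :
  size l = p -> size m = q ->
  \det (Vmat (fun k : 'I_p => nth 0%N l k) (fun k : 'I_q => nth 0%N m k) x a) =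
  col_det ([seq \col_(i < p + q) (1 * x`_i ^+ e) | e <- exponents l] ++
      [seq \col_(i < p + q) (a`_i * x`_i ^+ e) | e <- exponents m]).
Proof.
move=> sl sm; congr (\det _); apply/matrixP => i j; rewrite !mxE nth_cat.
have nthE r (l' : seq nat) (k : 'I_r) : size l' = r ->
    nth 0%N (exponents l') k = (nth 0%N l' (rev_ord k) + k)%N.
  move=> sl'; rewrite (nth_map 0%N) ?size_iota ?sl' // nth_iota ?sl' //.
  by rewrite add0n nth_rev ?sl'.
rewrite size_map size_map size_iota sl; case: split_ordP => k ->; rewrite /= ?mxE.
  by rewrite (nth_map 0%N) ?size_map ?size_iota ?sl // mxE mul1r nthE.
rewrite addKn.
by rewrite (nth_map 0%N) ?size_map ?size_iota ?sm // mxE nthE.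
Qed.

Lemma Ffun_col_det p q (x a : seq K) : (forall i : 'I_(p + q), x`_i != 0) ->
  Ffun p q x a =
  col_det ([seq \col_(i < p + q) (x`_i ^+ p.-1 * (x`_i + (x`_i)^-1) ^+ e) | e <- downto p] ++
      [seq \col_(i < p + q) (a`_i * x`_i ^+ q.-1 * (x`_i + (x`_i)^-1) ^+ e)
         | e <- downto q]).
Proof.
move=> x0; rewrite /Ffun.
have Vext (l l' : 'I_p -> nat) (m m' : 'I_q -> nat) : l =1 l' -> m =1 m' ->
    \det (Vmat l m x a) = \det (Vmat l' m' x a).
  move=> E1 E2; congr (\det _); apply/matrixP => i j; rewrite !mxE.
  by case: (split j) => k; rewrite ?E1 ?E2.
rewrite (sum_in_P (G := fun lam => \sum_(mu : {ffun 'I_q -> 'I_q.+1}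
    | in_P (fun k => val (mu k)))
    (-1) ^+ ((psize lam + psize (fun k => val (mu k)))./2)
    * \det (Vmat lam (fun k => val (mu k)) x a))); last first.
  move=> f g E; apply: eq_bigr => mu _; rewrite (Vext _ g _ (fun k => val (mu k))) //.
  by congr (_ ^+ _./2 * _); congr (_ + _)%N; apply: eq_bigr.
have psizeE r l : size l = r -> psize (fun k : 'I_r => nth 0%N l k) = sumn l.
  by move=> <-; rewrite sumnE (big_nth 0%N) big_mkord.
(* The sum over the second partition is collapsed here and that over the first is still open.
   [sum_shifted_parts_col_det] serves for each, the other block being [s1] or [s2]. *)
transitivity (\sum_(l <- shifted_parts p) (-1) ^+ (sumn l)./2 *
  col_det ([::] ++ [seq \col_(i < p + q) (1 * x`_i ^+ e) | e <- exponents l] ++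
    [seq \col_(i < p + q) (a`_i * x`_i ^+ q.-1 * (x`_i + (x`_i)^-1) ^+ e)
         | e <- downto q])); last first.
  rewrite (sum_shifted_parts_col_det (fun=> 1) (xs := fun i : 'I_(p + q) => x`_i)) //; last first.
    by rewrite size_map size_downto.
  rewrite cat0s; congr (col_det (_ ++ _)); apply: eq_map => e; apply/colP => i.
  by rewrite !mxE mul1r.
apply: eq_big_seq => l lP; have sl := size_shifted_parts lP.
rewrite (sum_in_P (G := fun mu => 
    (-1) ^+ ((psize (fun k : 'I_p => nth 0%N l k) + psize mu)./2)
    * \det (Vmat (fun k : 'I_p => nth 0%N l k) mu x a))); last first.
  move=> f g E; rewrite (Vext _ (fun k : 'I_p => nth 0%N l k) _ g) //.
  by congr (_ ^+ _./2 * _); congr (_ + _)%N; apply: eq_bigr.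
set s1 := [seq _ | e <- exponents l].
have ss1 : size s1 = p by rewrite !size_map size_iota.
have := @sum_shifted_parts_col_det (p + q) q (fun i => a`_i) (fun i => x`_i) s1 [::] x0.
rewrite ss1 addn0 => /(_ (leqnn _)); rewrite cats0 /= => <-.
rewrite mulr_sumr; apply: eq_big_seq => m mP; have sm := size_shifted_parts mP.
rewrite !psizeE // det_Vmat_col_det // mulrA -exprD cats0; congr (_ ^+ _ * _).
by have := even_shifted_parts lP; have := even_shifted_parts mP; lia.
Qed.

Definition V N p q (u a : nat -> K) : K :=
  col_det ([seq \col_(i < N) u i ^+ e | e <- downto p] ++
      [seq \col_(i < N) (a i * u i ^+ e) | e <- downto q]).

(** Taking [x^(n+p-1)] out of each row leaves the weight [a x^(q-p)] on the second block, the same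
    for every [n]; so the cases [n = 0], [n = 1] and general [n] share their weights. *)
Lemma Ffun_V n p q (x a : seq K) :
  (forall i : 'I_(n + p + (n + q)), x`_i != 0) ->
  Ffun (n + p) (n + q) x a =
  (\prod_(i < n + p + (n + q)) (x`_i ^+ (n + p) / x`_i)) *
  V (n + p + (n + q)) (n + p) (n + q) (fun i => x`_i + (x`_i)^-1)
    (fun i => a`_i * (x`_i ^+ q / x`_i ^+ p)).
Proof.
move=> x0; rewrite Ffun_col_det // -col_det_rows map_cat -!map_comp; congr (col_det (_ ++ _)).
  apply/eq_in_map => e; rewrite mem_downto => ep; apply/colP => i.
  rewrite !mxE /=; have := x0 i; move: (x`_i) => y y0.
  have E : y ^+ (n + p) = y * y ^+ (n + p).-1 by rewrite -exprS prednK //; lia.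
  by rewrite E; field.
apply/eq_in_map => e; rewrite mem_downto => ep; apply/colP => i.
rewrite !mxE /=; have := x0 i; move: (x`_i) => y y0.
have E : y ^+ (n + p) / y * y ^+ q / y ^+ p = y ^+ (n + q).-1.
  apply: (mulfI y0); rewrite -exprS prednK; last by lia.
  by rewrite !exprD; field; rewrite expf_neq0 // y0.
by rewrite -E; field; rewrite expf_neq0 // y0.
Qed.

End Joukowski.

(** * Factorization and the Cauchy-like determinant *)

(** Right multiplication by the blocks [[1, -be; 0, al]] clears the upper right corner, since
    diagonal matrices commute, and brings a factor [det al] that can be cancelled. *)
Lemma det_diag_block_reg (R : idomainType) n (al be : 'rV[R]_n) (G H : 'M[R]_n) :
  (forall i, al 0 i != 0) ->
  \det (block_mx (diag_mx al) (diag_mx be) G H) =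
  \det (H *m diag_mx al - G *m diag_mx be).
Proof.
move=> al0; have d0 : \det (diag_mx al) != 0 by rewrite det_diag; apply/prodf_neq0.
apply: (mulIf d0).
have := det_mulmx (block_mx (diag_mx al) (diag_mx be) G H)
   (block_mx 1%:M (- diag_mx be) 0 (diag_mx al)).
rewrite det_ublock det1 mul1r => <-; rewrite mulmx_block !mulmx1 !mulmx0 !addr0.
rewrite !mulmxN [diag_mx be *m _]diag_mxC addNr det_lblock.
by rewrite mulrC [in RHS]addrC.
Qed.

(* [al + 'X] is regular, which reduces the general case to the previous one. *)
Lemma det_diag_block (R : idomainType) n (al be : 'rV[R]_n) (G H : 'M[R]_n) :
  \det (block_mx (diag_mx al) (diag_mx be) G H) =
  \det (H *m diag_mx al - G *m diag_mx be).
Proof.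
pose al' : 'rV[{poly R}]_n := \row_i ((al 0 i)%:P + 'X).
have := @det_diag_block_reg {poly R} n al' (map_mx polyC be)
  (map_mx polyC G) (map_mx polyC H).
move=> /(_ _)/(congr1 (horner_eval 0)); rewrite -!det_map_mx.
rewrite map_block_mx map_mxB !map_mxM !map_diag_mx.
have ev m k (A : 'M[R]_(m, k)) : map_mx (horner_eval 0) (map_mx polyC A) = A.
  by apply/matrixP => i j; rewrite !mxE /= /horner_eval hornerC.
have -> : map_mx (horner_eval 0) al' = al.
  by apply/matrixP => i j; rewrite !mxE /horner_eval hornerD hornerC hornerX addr0 ord1.
rewrite !ev; apply => i; rewrite mxE -size_poly_gt0 addrC.
by rewrite size_XaddC.
Qed.

Section Interpolation.
Variable K : fieldType.

(** This is the discriminant: each pair of indices contributes two opposite differences, hence one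
    sign per pair. *)
Lemma prod_diff_Vandermonde n (x : 'I_n -> K) :
  \prod_i \prod_(l | l != i) (x i - x l) =
  (-1) ^+ (n * (n - 1) %/ 2) * (\det (Vandermonde n (\row_i x i))) ^+ 2.
Proof.
rewrite det_Vandermonde.
under [X in _ * X ^+ 2]eq_bigr do under eq_bigr do rewrite !mxE.
set D := (X in X ^+ 2).
have E i : \prod_(l | l != i) (x i - x l) =
    \prod_(l < n | (l < i)%N) (x i - x l) * 
    ((-1) ^+ (n - i.+1) * \prod_(l < n | (i < l)%N) (x l - x i)).
  rewrite (bigID (fun l : 'I_n => (l < i)%N)) /=; congr (_ * _).
    by apply: eq_bigl => l; rewrite -val_eqE /=; lia.
  rewrite (eq_bigl (fun l : 'I_n => (i < l)%N)); last first.
    by move=> l; rewrite -val_eqE /=; lia.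
  under eq_bigr do rewrite -opprB.
  rewrite prodrN; congr (_ ^+ _ * _).
  rewrite -sum1_card (eq_bigl (fun l : 'I_n => (i < l)%N)) //.
  rewrite -(big_mkord (fun l => (i < l)%N) (fun=> 1%N)).
  rewrite (big_cat_nat (n := i.+1)) //= big_nat_cond big_pred0 ?add0n; last first.
    by move=> l; lia.
  rewrite big_nat_cond (eq_bigl (fun l => i.+1 <= l < n)%N); last by move=> l; lia.
  by rewrite -big_nat sum_nat_const_nat muln1.
rewrite (eq_bigr _ (fun i _ => E i)) !big_split /= (exchange_big_dep predT) //= -/D.
rewrite mulrCA -expr2; congr (_ * _).
rewrite -expr_sum; congr (_ ^+ _).
rewrite -(big_mkord predT (fun i => n - i.+1)%N).
rewrite big_rev_mkord /= subn0 (eq_bigr (fun i : 'I_n => i : nat)); last first.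
  by move=> i _; have := ltn_ord i; lia.
by rewrite -(big_mkord predT id) /= divn2 subn1 -bin2 bin2_sum.
Qed.

Lemma rev_Vandermonde_sqr n (u : 'I_n -> K) :
  \det (\matrix_(i < n, k < n) u i ^+ rev_ord k) ^+ 2 =
  (-1) ^+ (n * (n - 1) %/ 2) * \prod_i \prod_(l | l != i) (u i - u l).
Proof.
set X := \matrix_(i, k) _.
have -> : X = (row_perm (perm rev_ord_inj) (Vandermonde n (\row_(i < n) u i)))^T.
  by apply/matrixP => i j; rewrite !mxE permE.
rewrite det_tr row_permE det_mulmx exprMn det_perm sqrr_sign mul1r.
by rewrite prod_diff_Vandermonde mulrA -exprD addnn -muln2 exprM sqrr_sign mul1r.
Qed.

Lemma rev_Vandermonde_neq0 n (u : 'I_n -> K) : injective u ->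
  \det (\matrix_(i < n, k < n) u i ^+ rev_ord k) != 0.
Proof.
move=> ui; rewrite -sqrf_eq0 rev_Vandermonde_sqr mulf_neq0 ?signr_eq0 //.
apply/prodf_neq0 => i _; apply/prodf_neq0 => l li.
by rewrite subr_eq0 (inj_eq ui) eq_sym.
Qed.

(** Multiply the matrix of [D] on the right by two diagonal copies of the coefficient matrix of the
    Lagrange polynomials at the first [n] nodes. The upper blocks become diagonal, and
    [det_diag_block] yields the matrix of [T], transposed and scaled by [dl]. *)
Lemma det_cauchy_wedge n (u ph ps : nat -> K) :
  (forall i j : 'I_n, i != j -> u i != u j) ->
  \det (\matrix_(i < n, j < n)
     ((ph i * ps (n + j)%N - ps i * ph (n + j)%N) *
      \prod_(k < n | k != i) (u (n + j)%N - u k))) =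
  (-1) ^+ (n * (n - 1) %/ 2) *
  col_det ([seq \col_(i < n + n) (u i ^+ e * ph i) | e <- downto n] ++
      [seq \col_(i < n + n) (u i ^+ e * ps i) | e <- downto n]).
Proof.
move=> udist; set T := \det _; set D := col_det _.
pose P (i : 'I_n) : {poly K} := \prod_(l < n | l != i) ('X - (u l)%:P).
have PE i z : (P i).[z] = \prod_(l < n | l != i) (z - u l).
  by rewrite horner_prod; apply: eq_bigr => l _; rewrite hornerXsubC.
have sP i : (size (P i) <= n)%N.
  rewrite /P size_prod => [|l _]; last by rewrite polyXsubC_eq0.
  rewrite (eq_bigr (fun=> 2%N)) => [|l _]; last by rewrite size_XsubC.
  rewrite sum_nat_const (_ : #|_| = n.-1); first by have := ltn_ord i; lia.
  by rewrite -[in RHS](card_ord n) -(cardC1 i); apply: eq_card.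
(* Coefficients go by decreasing degree to match [downto]. Thus [X *m C] evaluates the polynomials
   at the nodes, where [P i] vanishes except at its own. *)
pose C : 'M[K]_n := \matrix_(k, i) (P i)`_(rev_ord k).
have evC i z : \sum_(k < n) z ^+ (rev_ord k) * (P i)`_(rev_ord k) = (P i).[z].
  rewrite (horner_coef_wide _ (sP i)) (reindex_inj rev_ord_inj).
  by apply: eq_bigr => k _; rewrite rev_ordK mulrC.
pose X : 'M[K]_n := \matrix_(i, k) u i ^+ rev_ord k.
pose dl := \row_(i < n) \prod_(l | l != i) (u i - u l).
have XC : X *m C = diag_mx dl.
  apply/matrixP => i j; rewrite !mxE.
  rewrite (eq_bigr (fun k => u i ^+ rev_ord k * (P j)`_(rev_ord k))); last first.
    by move=> k _; rewrite !mxE.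
  rewrite evC PE; case: (eqVneq i j) => [->|ne]; first by rewrite mulr1n.
  by rewrite mulr0n (bigD1 i) //= subrr mul0r.
have d0 : \det (diag_mx dl) != 0.
  rewrite det_diag; apply/prodf_neq0 => i _; rewrite mxE; apply/prodf_neq0 => l li.
  by rewrite subr_eq0 udist // eq_sym.
have X2 : \det X ^+ 2 = (-1) ^+ (n * (n - 1) %/ 2) * \det (diag_mx dl).
  rewrite (rev_Vandermonde_sqr (fun i : 'I_n => u i)) det_diag.
  by congr (_ * _); apply: eq_bigr => i _; rewrite mxE.
pose Q (f : nat -> K) : 'M[K]_n := \matrix_(j, i) (f (n + j)%N * (P i).[u (n + j)%N]).
pose Z : 'M[K]_n := \matrix_(i, j)
     ((ph i * ps (n + j)%N - ps i * ph (n + j)%N) *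
      \prod_(k < n | k != i) (u (n + j)%N - u k)).
have key : D * (\det C * \det C) = T * \det (diag_mx dl).
  rewrite -(det_ublock C 0 C) -det_mulmx.
  set M := _ *m _.
  have -> : M = block_mx (diag_mx (\row_i (ph i * dl 0 i))) (diag_mx (\row_i (ps i * dl 0 i)))
     (Q ph) (Q ps).
    pose Y m (f : nat -> K) : 'M[K]_n :=
      \matrix_(i, k) (u (m + i)%N ^+ rev_ord k * f (m + i)%N).
    have YC m f : Y m f *m C = \matrix_(i, j) (f (m + i)%N * (P j).[u (m + i)%N]).
      apply/matrixP => i j; rewrite !mxE -evC mulr_sumr; apply: eq_bigr => k _.
      by rewrite !mxE mulrAC mulrC.
    have -> : M = block_mx (Y 0%N ph) (Y 0%N ps) (Y n ph) (Y n ps) *m block_mx C 0 0 C.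
      congr (_ *m _); apply/matrixP => i j; rewrite mxE nth_cat size_map size_downto.
      have nth_downto (k : 'I_n) : nth 0%N (downto n) k = rev_ord k.
        by rewrite nth_rev ?size_iota // nth_iota ?add0n //; have := ltn_ord k; lia.
      case: (split_ordP i) => i' ->; case: (split_ordP j) => j' ->;
      rewrite ?block_mxEul ?block_mxEur ?block_mxEdl ?block_mxEdr /=
        ?ltn_ord ?[(n + j' < n)%N]ltnNge ?leq_addr /= ?addKn
        (nth_map 0%N) ?size_downto ?ltn_ord // !mxE /= ?add0n nth_downto //.
    rewrite mulmx_block !mulmx0 !addr0 !add0r !YC; congr block_mx;
      apply/matrixP => i j; rewrite !mxE // add0n PE;
      (case: (eqVneq i j) => [->|ne];
        [by rewrite mulr1n | by rewrite mulr0n (bigD1 i) //= subrr mul0r mulr0]).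
  rewrite det_diag_block -[T]det_tr -det_mulmx; congr (\det _).
  apply/matrixP => j i; rewrite !mul_mx_diag !mxE PE; ring.
have XCd : \det X * \det C = \det (diag_mx dl) by rewrite -det_mulmx XC.
(* Squaring [XCd] lets [key] and the discriminant formula [X2] eliminate [\det C] and [\det X]. *)
have : D * \det (diag_mx dl) ^+ 2 =
   ((-1) ^+ (n * (n - 1) %/ 2) * T) * \det (diag_mx dl) ^+ 2.
  rewrite -{1}XCd exprMn mulrCA [\det C ^+ 2]expr2 key X2; ring.
move/(mulIf (expf_neq0 2 d0)) ->.
by rewrite mulrA -exprD addnn -muln2 exprM sqrr_sign mul1r.
Qed.

(** * Splitting off the rows at which [ph] and [ps] vanish *)

Section Reduction.
Variables (p q : nat) (u a : nat -> K) (f1 g1 f2 g2 : {poly K}).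
Hypotheses (sf1 : (size f1 <= p)%N) (sg1 : (size g1 <= q)%N).
Hypotheses (sf2 : (size f2 <= p)%N) (sg2 : (size g2 <= q)%N).

Let ph i := u i ^+ p + f1.[u i] + a i * g1.[u i].
Let ps i := a i * u i ^+ q + f2.[u i] + a i * g2.[u i].
Let U N e : 'cV[K]_N := \col_i u i ^+ e.
Let AU N e : 'cV[K]_N := \col_i (a i * u i ^+ e).
Let Ph N e : 'cV[K]_N := \col_i (u i ^+ e * ph i).
Let Ps N e : 'cV[K]_N := \col_i (u i ^+ e * ps i).

(** [Ph N n] differs from the column [u^(n+p)], and [Ps N n] from [a u^(n+q)], by lower columns
    still present in the list. The new columns are pushed into [s1] and [s2], and [n] decreases. *)
Lemma col_det_leading N n (s1 s2 : seq 'cV[K]_N) :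
  (size s1 + (n + p) + size s2 + (n + q) <= N)%N ->
  col_det (s1 ++ map (U N) (downto (n + p)) ++ s2 ++ map (AU N) (downto (n + q))) =
  col_det (s1 ++ map (Ph N) (downto n) ++ map (U N) (downto p) ++
      s2 ++ map (Ps N) (downto n) ++ map (AU N) (downto q)).
Proof.
have horner_iota (f : {poly K}) r z : (size f <= r)%N ->
    \sum_(e <- iota 0 r) f`_e * z ^+ e = f.[z].
  by move=> sf; rewrite (horner_coef_wide _ sf) -{1}(subn0 r) big_mkord.
elim: n s1 s2 => [|n IH] s1 s2 sN //.
rewrite !addSn !downtoS /=.
have PhE : Ph N n = U N (n + p) + \sum_(e <- iota 0 p) f1`_e *: U N (n + e)%N
    + \sum_(e <- iota 0 q) g1`_e *: AU N (n + e)%N.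
  apply/colP => i; rewrite !mxE !summxE /ph !mulrDr exprD; congr (_ + _ + _).
    rewrite -(horner_iota _ _ _ sf1) mulr_sumr; apply: eq_bigr => e _.
    by rewrite !mxE exprD mulrCA.
  rewrite -(horner_iota _ _ _ sg1) !mulr_sumr; apply: eq_bigr => e _.
  by rewrite !mxE exprD; ring.
have PsE : Ps N n = AU N (n + q) + \sum_(e <- iota 0 p) f2`_e *: U N (n + e)%N
    + \sum_(e <- iota 0 q) g2`_e *: AU N (n + e)%N.
  apply/colP => i; rewrite !mxE !summxE /ps !mulrDr exprD; congr (_ + _ + _).
  - by ring.
  - rewrite -(horner_iota _ _ _ sf2) mulr_sumr; apply: eq_bigr => e _.
    by rewrite !mxE exprD mulrCA.
  rewrite -(horner_iota _ _ _ sg2) !mulr_sumr; apply: eq_bigr => e _.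
  by rewrite !mxE exprD; ring.
pose LU := map (U N) (downto (n + p)); pose LA := map (AU N) (downto (n + q)).
have mU e : e \in iota 0 p -> U N (n + e)%N \in LU.
  by rewrite mem_iota => /= ep; apply: map_f; rewrite mem_downto ltn_add2l.
have mA e : e \in iota 0 q -> AU N (n + e)%N \in LA.
  by rewrite mem_iota => /= ep; apply: map_f; rewrite mem_downto ltn_add2l.
have sLU : size LU = (n + p)%N by rewrite size_map size_downto.
have sLA : size LA = (n + q)%N by rewrite size_map size_downto.
rewrite -/LU -/LA.
transitivity (col_det (rcons s1 (Ph N n) ++ LU ++ rcons s2 (Ps N n) ++ LA)); last first.
  by rewrite IH ?size_rcons ?cat_rcons //; lia.
rewrite !cat_rcons PhE col_det_replace; first last.
- by move=> e /mA eA; rewrite !(mem_cat, inE) eA !orbT.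
- by rewrite !size_cat /= !size_cat sLU /= sLA; lia.
rewrite col_det_replace; first last.
- by move=> e /mU eU; rewrite !(mem_cat, inE) eU !orbT.
- by rewrite !size_cat /= !size_cat sLU /= sLA; lia.
have assoc w : s1 ++ U N (n + p) :: LU ++ s2 ++ w :: LA =
    (s1 ++ U N (n + p) :: LU ++ s2) ++ w :: LA by rewrite -!catA /= -!catA.
rewrite !assoc PsE col_det_replace; first last.
- by move=> e /mA eA; rewrite !(mem_cat, inE) eA !orbT.
- by rewrite !size_cat /= !size_cat sLU /= sLA; lia.
rewrite col_det_replace //.
- by rewrite !size_cat /= !size_cat sLU /= sLA; lia.
by move=> e /mU eU; rewrite !(mem_cat, inE) eU !orbT.
Qed.

(** Bringing the [Ps] columns before the [p] powers of [u] costs [(-1)^(np)]. The first [n + n]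
    columns then vanish on the last [p + q] rows, so the matrix is block upper triangular. *)
Lemma V_factor N n : N = (n + n + (p + q))%N ->
  (forall i, (n + n <= i < N)%N -> ph i = 0 /\ ps i = 0) ->
  V N (n + p) (n + q) u a =
  (-1) ^+ (n * p) *
  col_det (map (Ph (n + n)) (downto n) ++ map (Ps (n + n)) (downto n)) *
  V (p + q) p q (fun i => u (n + n + i)%N) (fun i => a (n + n + i)%N).
Proof.
move=> -> van; have := @col_det_leading (n + n + (p + q)) n [::] [::].
rewrite /= => /(_ _) E; rewrite /V [LHS]E; last by lia.
rewrite col_det_move_block; last by rewrite !size_cat !size_map !size_downto; lia.
rewrite !size_map !size_downto mulnC -mulrA catA; congr (_ * _).
rewrite col_det_block ?size_cat ?size_map ?size_downto //.
  rewrite !map_cat -!map_comp; congr (_ * _); congr (col_det (_ ++ _));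
  by apply: eq_map => e; apply/colP => i; rewrite !mxE.
move=> c; rewrite mem_cat => /orP[] /mapP[e _ ->]; apply/colP => i; rewrite !mxE /=;
have [] := van (n + n + i)%N; rewrite ?leq_addr ?ltn_add2l ?ltn_ord // => E1 E2;
by rewrite ?E1 ?E2 mulr0.
Qed.

End Reduction.
Lemma eq_V N p q (u u' a a' : nat -> K) :
  (forall i, (i < N)%N -> u i = u' i) -> (forall i, (i < N)%N -> a i = a' i) ->
  V N p q u a = V N p q u' a'.
Proof.
move=> Eu Ea; congr (col_det (_ ++ _)); apply: eq_map => e; apply/colP => i;
by rewrite !mxE ?Eu ?Ea.
Qed.

(** This provides a nonvanishing specialization: zero weights on the first [p] rows make the matrix
    block lower triangular, with Vandermonde blocks on the diagonal up to nonzero row factors. *)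
Lemma V_neq0 p q (u a : nat -> K) : {in gtn (p + q) &, injective u} ->
  (forall i, (i < p)%N -> a i = 0) -> (forall i, (p <= i)%N -> a i != 0) ->
  V (p + q) p q u a != 0.
Proof.
move=> ui a0 a1; rewrite /V /col_det; set M := (X in \det X).
pose A : 'M[K]_p := \matrix_(i, k) u i ^+ rev_ord k.
pose B : 'M[K]_q := \matrix_(i, k) u (p + i)%N ^+ rev_ord k.
pose C : 'M[K]_(q, p) := \matrix_(i, k) u (p + i)%N ^+ rev_ord k.
have -> : M = block_mx A 0 C (diag_mx (\row_i a (p + i)%N) *m B).
  apply/matrixP => i j; rewrite mxE nth_cat size_map size_downto.
  case: (split_ordP i) => i' ->; case: (split_ordP j) => j' ->;
  rewrite ?block_mxEul ?block_mxEur ?block_mxEdl ?block_mxEdr /=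
    ?ltn_ord ?[(p + j' < p)%N]ltnNge ?leq_addr /= ?addKn
    (nth_map 0%N) ?size_downto ?ltn_ord // ?mul_diag_mx !mxE nth_downto //=.
  by rewrite a0 // mul0r.
rewrite det_lblock det_mulmx det_diag !mulf_neq0 //.
- by apply: rev_Vandermonde_neq0 => i j /ui E; apply: val_inj; apply: E;
    rewrite inE /=; [have := ltn_ord i | have := ltn_ord j]; lia.
- by apply/prodf_neq0 => i _; rewrite mxE a1 // leq_addr.
apply: rev_Vandermonde_neq0 => i j /ui E; apply: val_inj; apply: (@addnI p); apply: E;
  by rewrite inE /= ltn_add2l.
Qed.

(** The solution of an invertible linear system lists the coefficients of [f] and [g] by decreasing
    degree. Taking [b] to be minus the next power column produces a combination that vanishes at
    every point. *)
Lemma V_interpolation p q (u a b : nat -> K) : V (p + q) p q u a != 0 ->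
  exists f g : {poly K}, [/\ (size f <= p)%N, (size g <= q)%N &
    forall i, (i < p + q)%N -> f.[u i] + a i * g.[u i] = b i].
Proof.
rewrite /V /col_det; set M := (X in \det X) => dM.
have Mu : M \in unitmx by rewrite unitmxE unitfE.
pose w := invmx M *m (\col_i b i).
have Mw : M *m w = \col_i b i by rewrite mulKVmx.
have sz r (h : 'I_r -> K) : (size (\sum_(j < r) h j *: 'X^(rev_ord j))%R <= r)%N.
  apply: leq_trans (size_sum _ _ _) _; apply/bigmax_leqP => j _.
  by apply: leq_trans (size_scale_leq _ _) _; rewrite size_polyXn ltn_ord.
exists (\sum_(j < p) w (lshift q j) 0 *: 'X^(rev_ord j)).
exists (\sum_(j < q) w (rshift p j) 0 *: 'X^(rev_ord j)); split; rewrite ?sz //.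
move=> i ip; move/matrixP/(_ (Ordinal ip) 0): Mw; rewrite !mxE /= => <-.
have nth_downto r (k : 'I_r) : nth 0%N (downto r) k = rev_ord k.
  by rewrite nth_rev ?size_iota // nth_iota ?add0n //; have := ltn_ord k; lia.
rewrite big_split_ord /= !horner_sum mulr_sumr; congr (_ + _); apply: eq_bigr => k _;
  rewrite hornerZ hornerXn !mxE nth_cat size_map size_downto /=.
  by rewrite ltn_ord (nth_map 0%N) ?size_downto // mxE nth_downto mulrC.
rewrite ltnNge leq_addr /= addKn (nth_map 0%N) ?size_downto // mxE nth_downto /=; ring.
Qed.

End Interpolation.

(** * The identity for generic data *)

(** Column [j] is multiplied by all its denominators, so entry [(i, j)] keeps those with [k != i].
    No division remains, and the expression makes sense over any commutative ring. *)
Definition cleared_lhs (R : comNzRingType) (n p q : nat) (x y z a b c : seq R) : R :=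
  \det (\matrix_(i < n, j < n)
     (Ffun p.+1 q.+1 (x`_i :: y`_j :: z) (a`_i :: b`_j :: c) *
      \prod_(k < n | k != i) ((y`_j - x`_k) * (1 - x`_k * y`_j)))).

Definition cleared_rhs (R : comNzRingType) (n p q : nat) (x y z a b c : seq R) : R :=
  (-1) ^+ (n * (n - 1) %/ 2) * Ffun p q z c ^+ (n - 1) *
  Ffun (n + p) (n + q) (x ++ y ++ z) (a ++ b ++ c).

Lemma prod_nth (R : comNzRingType) N (l : seq R) (g : R -> R) : size l = N ->
  \prod_(i < N) g l`_i = \prod_(t <- l) g t.
Proof. by move=> <-; rewrite (big_nth 0) big_mkord. Qed.

Lemma prod_offdiag (R : comNzRingType) n (f : 'I_n -> R) :
  \prod_i \prod_(k | k != i) f k = \prod_k f k ^+ (n - 1).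
Proof.
rewrite (exchange_big_dep predT) //=; apply: eq_bigr => k _.
rewrite prodr_const subn1 -[in RHS](card_ord n) -(cardC1 k).
by congr (_ ^+ _); apply: eq_card => i; rewrite !inE eq_sym.
Qed.

Section Generic.
Variable K : fieldType.

Lemma cleared_generic n p q (x y z a b c : seq K) : (0 < n)%N ->
  size x = n -> size y = n -> size z = (p + q)%N ->
  size a = n -> size b = n -> 
  (forall t, t \in x ++ y ++ z -> t != 0) ->
  (forall i j : 'I_n, i != j -> x`_i + (x`_i)^-1 != x`_j + (x`_j)^-1) ->
  Ffun p q z c != 0 ->
  cleared_lhs n p q x y z a b c = cleared_rhs n p q x y z a b c.
Proof.
move=> n0 sx sy sz sa sb nz xd F0.
pose J (t : K) := t + t^-1; pose tw t al : K := al * (t ^+ q / t ^+ p).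
have zn (i : 'I_(p + q)) : z`_i != 0.
  by apply: nz; rewrite !mem_cat mem_nth ?sz // !orbT.
have xn (i : 'I_n) : x`_i != 0 by apply: nz; rewrite !mem_cat mem_nth ?sx.
have yn (i : 'I_n) : y`_i != 0 by apply: nz; rewrite !mem_cat mem_nth ?sy // orbT.
pose uz i := J z`_i; pose az i := tw z`_i c`_i.
pose de := V (p + q) p q uz az.
have FzE : Ffun p q z c = (\prod_(t <- z) (t ^+ p / t)) * de.
  rewrite (@Ffun_V K 0 p q z c zn); congr (_ * _).
  exact: (prod_nth (fun t => t ^+ p / t) sz).
have de0 : de != 0 by move: F0; rewrite FzE mulf_eq0 => /norP[].
(* The right-hand sides are chosen so that [ph] and [ps] below vanish at the points of [z]. *)
have [f1 [g1 [sf1 sg1 H1]]] := V_interpolation (fun i => - uz i ^+ p) de0.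
have [f2 [g2 [sf2 sg2 H2]]] := V_interpolation (fun i => - (az i * uz i ^+ q)) de0.
pose X := x ++ y ++ z; pose Al := a ++ b ++ c.
pose u i := J X`_i; pose al i := tw X`_i Al`_i.
pose ph i := u i ^+ p + f1.[u i] + al i * g1.[u i].
pose ps i := al i * u i ^+ q + f2.[u i] + al i * g2.[u i].
have Xx (i : 'I_n) : X`_i = x`_i by rewrite nth_cat sx ltn_ord.
have Xy (i : 'I_n) : X`_(n + i) = y`_i.
  by rewrite nth_cat sx ltnNge leq_addr /= addKn nth_cat sy ltn_ord.
have Xz i : X`_(n + n + i) = z`_i.
  by rewrite -addnA nth_cat sx ltnNge leq_addr /= addKn nth_cat sy ltnNge leq_addr /= addKn.
have Ax (i : 'I_n) : Al`_i = a`_i by rewrite nth_cat sa ltn_ord.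
have Ay (i : 'I_n) : Al`_(n + i) = b`_i.
  by rewrite nth_cat sa ltnNge leq_addr /= addKn nth_cat sb ltn_ord.
have Az i : Al`_(n + n + i) = c`_i.
  by rewrite -addnA nth_cat sa ltnNge leq_addr /= addKn nth_cat sb ltnNge leq_addr /= addKn.
have sX : size X = (n + p + (n + q))%N by rewrite !size_cat sx sy sz; lia.
have FbigE : Ffun (n + p) (n + q) X Al =
  (\prod_(t <- X) (t ^+ (n + p) / t)) *
  ((-1) ^+ (n * p) *
   col_det ([seq \col_(i < n + n) (u i ^+ e * ph i) | e <- downto n] ++
       [seq \col_(i < n + n) (u i ^+ e * ps i) | e <- downto n]) * de).
  rewrite Ffun_V; last by move=> i; apply: nz; rewrite mem_nth // sX.
  rewrite (prod_nth (fun t => t ^+ (n + p) / t) sX); congr (_ * _).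
  rewrite (@V_factor K p q u al f1 g1 f2 g2 sf1 sg1 sf2 sg2 _ n).
  - by congr (_ * _); apply: eq_V => i _; rewrite /u /al Xz ?Az.
  - by lia.
  move=> i /andP[i1 i2]; have -> : i = (n + n + (i - (n + n)))%N by lia.
  have ip : (i - (n + n) < p + q)%N by lia.
  rewrite /u /al Xz Az; split.
    by rewrite -addrA H1 // addrN.
  by rewrite -addrA H2 // addrN.
(* The same factorization with [n = 1], on the rows [x_i], [y_j], [z]. The four polynomials are
   fixed by [z] and [c], so they serve every entry. *)
have FsmallE (i j : 'I_n) : Ffun p.+1 q.+1 (x`_i :: y`_j :: z) (a`_i :: b`_j :: c) =
  (x`_i ^+ p * y`_j ^+ p * \prod_(t <- z) t ^+ p) *
  ((-1) ^+ p * (ph i * ps (n + j)%N - ps i * ph (n + j)%N) * de).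
  pose l := x`_i :: y`_j :: z; pose al' := a`_i :: b`_j :: c.
  have sl : size l = (1 + p + (1 + q))%N by rewrite /= sz; lia.
  have gE (t : K) : t != 0 -> t ^+ (1 + p) / t = t ^+ p.
    by move=> t0; rewrite exprS mulrAC mulfV // mul1r.
  rewrite (@Ffun_V K 1 p q l al'); last first.
    move=> k; apply: nz; have /(mem_nth 0) : (k < size l)%N by rewrite sl.
    move: (l`_k) => t; rewrite !inE => /or3P[/eqP->|/eqP->|tz].
    - by rewrite !mem_cat mem_nth ?sx.
    - by rewrite !mem_cat mem_nth ?sy ?orbT.
    - by rewrite !mem_cat tz !orbT.
  rewrite (prod_nth (fun t => t ^+ (1 + p) / t) sl) !big_cons !gE // -mulrA.
  rewrite -!mulrA; do 2!congr (_ * _).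
  rewrite (eq_big_seq (fun t => t ^+ p)) => [|t tz]; last first.
    by rewrite gE //; apply: nz; rewrite !mem_cat tz !orbT.
  congr (_ * _).
  pose u' i := J l`_i; pose a1 i := tw l`_i al'`_i.
  pose ph' i := u' i ^+ p + f1.[u' i] + a1 i * g1.[u' i].
  pose ps' i := a1 i * u' i ^+ q + f2.[u' i] + a1 i * g2.[u' i].
  rewrite (@V_factor K p q u' a1 f1 g1 f2 g2 sf1 sg1 sf2 sg2 _ 1); first last.
  - move=> [|[|k]] //= /ltP kN; rewrite /u' /a1 /=.
    have {}kN : (k < p + q)%N by lia.
    split; first by rewrite -addrA H1 // addrN.
    by rewrite -addrA H2 // addrN.
  - by lia.
  rewrite mul1n -!mulrA; congr (_ * (_ * _)).
  (* In size one this is the expansion of a two by two determinant. *)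
  have := @det_cauchy_wedge K 1 u' ph' ps'; rewrite muln0 div0n expr0 mul1r => <-.
    rewrite det_mx11 mxE big_pred0 => [|k]; last by rewrite !ord1 eqxx.
    by rewrite mulr1 /ph' /ps' /u' /a1 /= /ph /ps /u /al Xx Xy Ax Ay.
  by move=> k k'; rewrite !ord1 eqxx.
rewrite /cleared_lhs /cleared_rhs FzE FbigE.
pose T : 'M[K]_n := \matrix_(i, j)
  ((ph i * ps (n + j)%N - ps i * ph (n + j)%N) *
      \prod_(k < n | k != i) (u (n + j)%N - u k)).
(* [ka] is common to all entries. The product of [- x_k] over [k != i] depends only on the row and
   the power of [y_j] only on the column; [T] is what is left. *)
pose ka := (\prod_(t <- z) t ^+ p) * (-1) ^+ p * de.
pose r := \row_(i < n) (ka * (x`_i ^+ p * \prod_(k < n | k != i) (- x`_k))).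
pose s := \row_(j < n) (y`_j ^+ (p + (n - 1))).
have dE (k j : 'I_n) : (y`_j - x`_k) * (1 - x`_k * y`_j) =
    - x`_k * y`_j * (u (n + j)%N - u k).
  by rewrite /u /J Xx Xy; have := xn k; have := yn j; move: (x`_k) (y`_j) => t t' h h'; field; rewrite h h'.
rewrite (_ : \matrix_(i, j) _ = diag_mx r *m T *m diag_mx s); last first.
  apply/matrixP => i j; rewrite mul_mx_diag mul_diag_mx !mxE FsmallE.
  rewrite (eq_bigr _ (fun k _ => dE k j)) !big_split /= prodr_const.
  rewrite (_ : #|_| = (n - 1)%N); last first.
    by rewrite subn1 -[in RHS](card_ord n) -(cardC1 i); apply: eq_card.
  by rewrite exprD /ka; ring.
rewrite !det_mulmx !det_diag det_cauchy_wedge; last first.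
  by move=> i j ij; rewrite /u !Xx; apply: xd.
pose g (t : K) := t ^+ (n + p) / t.
have hy : \prod_i s 0 i = \prod_(t <- y) g t.
  rewrite -(prod_nth g sy); apply: eq_bigr => i _; rewrite mxE /g.
  by apply: (mulIf (yn i)); rewrite divfK // -exprSr; congr (_ ^+ _); lia.
have hx : \prod_i r 0 i = ka ^+ n * \prod_(t <- x) g t.
  under eq_bigr do rewrite mxE.
  rewrite big_split /= prodr_const card_ord; congr (_ * _).
  rewrite big_split /= prod_offdiag -big_split -(prod_nth g sx) /=.
  under eq_bigr do rewrite exprNn mulrCA.
  rewrite big_split /= prodr_const card_ord -exprM -signr_odd.
  (* [n (n - 1)] is even, so the signs of the [- x_k] cancel. *)
  rewrite (_ : odd _ = false) ?mul1r; last by move: n0; case: (n) => // m _; rewrite subn1 [_.-1]/= oddM oddS; case: odd.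
  apply: eq_bigr => i _; rewrite /g.
  by apply: (mulIf (xn i)); rewrite divfK // -exprD -exprSr; congr (_ ^+ _); lia.
(* The exponents balance: [n p = (n - 1)(p - 1) + (n + p - 1)]. *)
have hz : (\prod_(t <- z) t ^+ p) ^+ n =
    (\prod_(t <- z) (t ^+ p / t)) ^+ (n - 1) * \prod_(t <- z) g t.
  rewrite -!prodrXl -big_split /=; apply: eq_big_seq => t tz.
  have t0 : t != 0 by apply: nz; rewrite !mem_cat tz !orbT.
  rewrite /g; move: n0; case: (n) => // m _; rewrite subn1 /= exprMn exprVn.
  rewrite [(t ^+ p) ^+ _]exprS [t ^+ (_ + _)]exprD [t ^+ m.+1]exprS.
  by field; rewrite expf_neq0 // t0.
rewrite hx hy /X !big_cat /= -/g /ka !exprMn hz -!exprM mulnC.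
have -> : de ^+ n = de ^+ (n - 1) * de by rewrite -exprSr; congr (_ ^+ _); lia.
set D := col_det _; rewrite -/(g _); ring.
Qed.
End Generic.

(** * Removing the genericity assumptions *)

Section Transfer.
Variables (A B : comNzRingType) (f : {rmorphism A -> B}).

Lemma Ffun_map p q (x a : seq A) :
  f (Ffun p q x a) = Ffun p q (map f x) (map f a).
Proof.
rewrite /Ffun rmorph_sum; apply: eq_bigr => l _.
rewrite rmorph_sum; apply: eq_bigr => m _.
rewrite rmorphM rmorphXn rmorphN1 -det_map_mx; congr (_ * \det _).
apply/matrixP => i j; rewrite !mxE; case: (split j) => k.
  by rewrite rmorphXn nth0_map ?rmorph0.
by rewrite rmorphM rmorphXn !nth0_map ?rmorph0.
Qed.

Lemma cleared_lhs_map n p q (x y z a b c : seq A) :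
  f (cleared_lhs n p q x y z a b c) =
  cleared_lhs n p q (map f x) (map f y) (map f z) (map f a) (map f b) (map f c).
Proof.
rewrite /cleared_lhs -det_map_mx; congr (\det _); apply/matrixP => i j.
rewrite !mxE rmorphM Ffun_map /= !nth0_map ?rmorph0 //; congr (_ * _).
rewrite rmorph_prod; apply: eq_bigr => k _.
by rewrite rmorphM !rmorphB rmorph1 rmorphM !nth0_map ?rmorph0.
Qed.

Lemma cleared_rhs_map n p q (x y z a b c : seq A) :
  f (cleared_rhs n p q x y z a b c) =
  cleared_rhs n p q (map f x) (map f y) (map f z) (map f a) (map f b) (map f c).
Proof.
by rewrite /cleared_rhs !rmorphM !rmorphXn rmorphN1 !Ffun_map !map_cat.
Qed.

End Transfer.

(** The two values differ by [(t - s)(1 - s t) / (s t)]. *)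
Lemma Joukowski_neq (K : fieldType) (s t : K) :
  s != 0 -> t != 0 -> s != t -> 1 - s * t != 0 -> s + s^-1 != t + t^-1.
Proof.
move=> s0 t0 st st1; rewrite -subr_eq0.
have -> : s + s^-1 - (t + t^-1) = - ((s - t) * (1 - s * t) / (s * t)).
  by field; rewrite s0 t0.
by rewrite oppr_eq0 !mulf_neq0 ?invr_eq0 ?mulf_neq0 // subr_eq0.
Qed.

Lemma Xn_inj (R : nzRingType) : injective (fun i : nat => 'X^i : {poly R}).
Proof. by move=> i j /(congr1 (size \o val)) /=; rewrite !size_polyXn => -[]. Qed.

Lemma subr1_Xn_neq0 (R : nzRingType) i j :
  1 - 'X^(i.+1) * 'X^(j.+1) != 0 :> {poly R}.
Proof. by rewrite -exprD subr_eq0 -(expr0 'X); apply/eqP => /Xn_inj. Qed.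

(** Powers of the indeterminate supply enough distinct points even over a finite field, and positive
    exponents keep a product of two of them from being [1]. The weights are those of [V_neq0]. *)
Lemma Ffun_Xn_neq0 (R : fieldType) p q :
  Ffun p q (mkseq (fun i => 'X^(i.+1) : {poly R}) (p + q))
    (mkseq (fun i => (p <= i)%:R) (p + q)) != 0.
Proof.
rewrite -tofrac_eq0 Ffun_map.
have nthx i : (i < p + q)%N ->
    [seq tofrac t | t <- mkseq (fun i => 'X^(i.+1) : {poly R}) (p + q)]`_i = tofrac 'X^(i.+1).
  by move=> ip; rewrite nth0_map ?tofrac0 // nth_mkseq.
have X0 i : tofrac ('X^i : {poly R}) != 0 by rewrite tofrac_eq0 monic_neq0 ?monicXn.
rewrite (@Ffun_V _ 0 p q); last by move=> i; rewrite nthx.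
apply: mulf_neq0.
  by apply/prodf_neq0 => i _; rewrite nthx ?mulf_neq0 ?invr_eq0 ?expf_neq0.
rewrite (@eq_V _ _ _ _ _ (fun i => tofrac 'X^(i.+1) + (tofrac 'X^(i.+1))^-1)
  _ (fun i => (p <= i)%:R *
     (tofrac 'X^(i.+1) ^+ q / tofrac 'X^(i.+1) ^+ p))); first last.
- by move=> i ip; rewrite nthx // nth0_map ?tofrac0 // nth_mkseq // rmorph_nat.
- by move=> i ip; rewrite nthx.
apply: V_neq0 => [i j _ _|i ip|i ip].
- apply: contra_eq => ij; apply: Joukowski_neq => //.
    by rewrite -subr_eq0 -tofracB tofrac_eq0 subr_eq0; apply: contra_neq ij => /Xn_inj [].
  by rewrite -tofracM -tofrac1 -tofracB tofrac_eq0 subr1_Xn_neq0.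
- by rewrite leqNgt ip mul0r.
- by rewrite ip mul1r mulf_neq0 ?invr_eq0 ?expf_neq0.
Qed.

Section Deformation.
Variable R : fieldType.

(* Interpolates between the data [s] (at ['X = 0]) and the generic data [w] (at ['X = 1]). *)
Definition deform (s : seq R) (w : nat -> {poly R}) : seq {poly {poly R}} :=
  mkseq (fun i => (s`_i)%:P%:P + 'X * (w i - (s`_i)%:P)%:P) (size s).

Lemma deform0 s w : map (horner_eval 0) (map (horner_eval 0) (deform s w)) = s.
Proof.
rewrite -[RHS](mkseq_nth 0) /deform /mkseq -!map_comp; apply: eq_map => i /=.
by rewrite /horner_eval hornerD hornerM !hornerC hornerX mul0r addr0 hornerC.
Qed.

Lemma deform1 s w : map (horner_eval 1) (deform s w) = mkseq w (size s).
Proof.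
rewrite /deform /mkseq -!map_comp; apply: eq_map => i /=.
by rewrite /horner_eval hornerD hornerM !hornerC hornerX mul1r subrKC.
Qed.

(** Both sides commute with ring morphisms, so the identity for the deformed data gives the result
    on evaluating both variables at [0]. The deformed data live in a domain, and [cleared_generic]
    applies in its fraction field. *)
Lemma cleared_identity n p q (x y z a b c : seq R) : (0 < n)%N ->
  size x = n -> size y = n -> size z = (p + q)%N ->
  size a = n -> size b = n -> size c = (p + q)%N ->
  cleared_lhs n p q x y z a b c = cleared_rhs n p q x y z a b c.
Proof.
move=> n0 sx sy sz sa sb sc.
(* The targets of [z] and [c] are the data of [Ffun_Xn_neq0], and the powers also separate the
   [x_i]; [a] and [b] are simply sent to [0]. *)
pose w i : {poly R} := 'X^(i.+1); pose w0 (i : nat) : {poly R} := 0.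
pose wc i : {poly R} := (p <= i)%:R.
suff E : cleared_lhs n p q (deform x w) (deform y w) (deform z w)
           (deform a w0) (deform b w0) (deform c wc) =
         cleared_rhs n p q (deform x w) (deform y w) (deform z w)
           (deform a w0) (deform b w0) (deform c wc).
  have := congr1 (horner_eval 0 \o horner_eval 0) E.
  by rewrite /= !cleared_lhs_map !cleared_rhs_map !deform0.
apply/eqP; rewrite -tofrac_eq cleared_lhs_map cleared_rhs_map; apply/eqP.
pose e1 : {rmorphism {poly {poly R}} -> {poly R}} := horner_eval 1.
(* Nonvanishing can be tested at ['X = 1], where the deformation reaches its targets. *)
have ev1 t : e1 t != 0 -> t != 0.
  by apply: contra_neq => ->; rewrite rmorph0.
have dw s i : (i < size s)%N -> e1 (deform s w)`_i = 'X^(i.+1).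
  by move=> si; rewrite -nth0_map ?rmorph0 // deform1 nth_mkseq.
have d0 s t : t \in map (@tofrac _) (deform s w) -> t != 0.
  case/mapP => t' /(nthP 0)[i]; rewrite size_mkseq => si <- ->.
  by rewrite tofrac_eq0 ev1 // dw // monic_neq0 ?monicXn.
apply: cleared_generic; rewrite ?size_map ?size_iota //.
- by move=> t; rewrite !mem_cat => /or3P[] /d0.
- move=> i j ij; have di (k : 'I_n) : (k < size x)%N by rewrite sx.
  have dm (k : 'I_n) : (map (@tofrac _) (deform x w))`_k \in map (@tofrac _) (deform x w).
    by rewrite mem_nth // size_map size_mkseq.
  apply: Joukowski_neq; rewrite ?(d0 x _ (dm _)) // !(nth0_map _ _ (tofrac0 _)).
    rewrite tofrac_eq -subr_eq0 ev1 // rmorphB !dw // subr_eq0.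
    by apply: contra_neq ij => /Xn_inj [] /val_inj.
  by rewrite -tofracM -tofrac1 -tofracB tofrac_eq0 ev1 // rmorphB rmorph1 rmorphM !dw // subr1_Xn_neq0.
rewrite -(Ffun_map (@tofrac {poly {poly R}})) tofrac_eq0 ev1 // Ffun_map !deform1 sz sc.
exact: Ffun_Xn_neq0.
Qed.

End Deformation.

(** The indeterminates are represented by elements of a field with nonzero denominators; a field of
    rational functions gives the identity in true indeterminates. *)
Theorem mainTheorem1 (R : fieldType) (n p q : nat)
  (x y a b : n.-tuple R) (z c : (p + q).-tuple R) :
  (0 < n)%N ->
  (forall i j : 'I_n, (y`_j - x`_i) * (1 - x`_i * y`_j) != 0) ->
  \det (\matrix_(i < n, j < n)
          (Ffun p.+1 q.+1 (x`_i :: y`_j :: z) (a`_i :: b`_j :: c)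
           / ((y`_j - x`_i) * (1 - x`_i * y`_j))))
  = (-1) ^+ (n * (n - 1) %/ 2)
    / (\prod_(i < n) \prod_(j < n) ((y`_j - x`_i) * (1 - x`_i * y`_j)))
    * Ffun p q z c ^+ (n - 1)
    * Ffun (n + p) (n + q) (x ++ y ++ z) (a ++ b ++ c).
Proof.
move=> n0 dn0; pose d (i j : 'I_n) := (y`_j - x`_i) * (1 - x`_i * y`_j).
have := cleared_identity n0 (size_tuple x) (size_tuple y) (size_tuple z)
  (size_tuple a) (size_tuple b) (size_tuple c).
rewrite /cleared_lhs /cleared_rhs; set Z := \matrix_(i, j) _ => E.
(* Dividing column [j] of the cleared matrix by all the [d k j] leaves exactly the denominator
   [d i j] in entry [(i, j)]. *)
rewrite (_ : \matrix_(i, j) _ = Z *m diag_mx (\row_j (\prod_k d k j)^-1)); last first.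
  apply/matrixP => i j; rewrite mul_mx_diag !mxE.
  rewrite [X in _ = _ * X^-1](bigD1 i) //= -/(d i j).
  set P := \prod_(k | k != i) d k j; have D0 : d i j != 0 := dn0 i j.
  have P0 : P != 0 by apply/prodf_neq0 => k _; apply: dn0.
  by field; rewrite P0 D0.
rewrite det_mulmx E det_diag [in RHS]exchange_big /=.
under eq_bigr do rewrite mxE.
by rewrite prodfV -!mulrA [LHS]mulrCA; ring.
Qed.
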